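(* Let $D$ be a division ring with uncountable center. Then every subnormal subgroup of $D^*$ which contains a non-abelian solvable subgroup contains a non-abelian free subgroup.
   Context: $D^*$ denotes the multiplicative group of nonzero elements of $D$. A subgroup $N$ of a group $G$ is subnormal if there is a finite series $N=N_n\triangleleft N_{n-1}\triangleleft\cdots\triangleleft N_0=G$, each term being normal in the next larger one. *)

(* Defs.v *)
From HB Require Import structures.
From mathcomp Require Import all_boot all_order all_algebra.
From mathcomp Require Import all_classical.

Set Implicit Arguments.
Unset Strict Implicit.
Unset Printing Implicit Defensive.

Import GRing.Theory.
Local Open Scope classical_set_scope.

Section Groups.
Local Open Scope group_scope.
Variable G : groupType.
Implicit Types H K X : set G.

Definition is_subgroup H : Prop := group_closed [in H].

Definition generated X : set G := smallest is_subgroup X.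

Definition is_abelian H : Prop :=
  forall x y, H x -> H y -> commute x y.

Definition is_normal H K : Prop :=
  [/\ is_subgroup H, is_subgroup K, H `<=` K
    & forall x y, H x -> K y -> H (x ^ y)].

(* The values of [N_] beyond [n] are irrelevant. *)
Definition is_subnormal H : Prop :=
  exists (n : nat) (N_ : nat -> set G),
    [/\ N_ 0%N = [set: G], N_ n = H
      & forall i, (i < n)%N -> is_normal (N_ i.+1) (N_ i)].

Definition derived H : set G :=
  generated [set z | exists x y, [/\ H x, H y & z = [~ x, y]]].

Definition is_solvable H : Prop :=
  exists n : nat, iter n derived H = [set 1].

(* The pair [(x, true)] stands for the letter x, and [(x, false)] for the
   formal inverse of x. *)
Definition letter : Type := (G * bool)%type.

Definition letter_val (a : letter) : G := if a.2 then a.1 else a.1^-1.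

Definition word_val (w : seq letter) : G := \prod_(a <- w) letter_val a.

Definition cancelling (a b : letter) : bool := (a.1 == b.1) && (a.2 != b.2).

Definition reduced (w : seq letter) : bool :=
  sorted (fun a b => ~~ cancelling a b) w.

Definition free_basis X H : Prop :=
  generated X = H /\
  forall w : seq letter, (forall a, a \in w -> X a.1) ->
    reduced w -> w <> [::] -> word_val w <> 1.

Definition is_free H : Prop := exists X, free_basis X H.

End Groups.

Local Open Scope ring_scope.

HB.mixin Record UnitRing_isDivRing R of GRing.UnitRing R := {
  divring_unit : GRing.field_axiom R
}.

#[short(type="divRingType")]
HB.structure Definition DivRing :=
  { R of UnitRing_isDivRing R & GRing.UnitRing R }.

Definition ring_center (R : nzRingType) : set R :=
  [set z | forall x, GRing.comm z x].
Arguments ring_center R : clear implicits.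

Definition nonzero (D : divRingType) : Type := {x : D | x != 0}.

Section MultiplicativeGroup.
Variable D : divRingType.

HB.instance Definition _ := Choice.on (nonzero D).
HB.instance Definition _ := SubType.on (nonzero D).

Lemma nonzero_unit (x : nonzero D) : val x \is a GRing.unit.
Proof. exact: divring_unit (valP x). Qed.

Lemma nonzero_mul_subproof (x y : nonzero D) : val x * val y != 0.
Proof.
apply/negP => /eqP /(congr1 ( *%R (val x)^-1)).
rewrite mulKr ?nonzero_unit // mulr0 => y0.
by have := valP y; rewrite y0 eqxx.
Qed.

Lemma nonzero_inv_subproof (x : nonzero D) : (val x)^-1 != 0.
Proof.
apply/negP => /eqP x0; have := nonzero_unit x.
by rewrite -unitrV x0 unitr0.
Qed.

Definition nonzero_one : nonzero D := exist _ 1 (oner_neq0 D).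
Definition nonzero_mul (x y : nonzero D) : nonzero D :=
  exist _ (val x * val y) (nonzero_mul_subproof x y).
Definition nonzero_inv (x : nonzero D) : nonzero D :=
  exist _ (val x)^-1 (nonzero_inv_subproof x).

Lemma nonzero_mulA : associative nonzero_mul.
Proof. by move=> x y z; apply: val_inj; exact: mulrA. Qed.

Lemma nonzero_mul1x : left_id nonzero_one nonzero_mul.
Proof. by move=> x; apply: val_inj; exact: mul1r. Qed.

Lemma nonzero_mulx1 : right_id nonzero_one nonzero_mul.
Proof. by move=> x; apply: val_inj; exact: mulr1. Qed.

Lemma nonzero_mulVx : left_inverse nonzero_one nonzero_inv nonzero_mul.
Proof. by move=> x; apply: val_inj; exact: mulVr (nonzero_unit x). Qed.

Lemma nonzero_mulxV : right_inverse nonzero_one nonzero_inv nonzero_mul.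
Proof. by move=> x; apply: val_inj; exact: mulrV (nonzero_unit x). Qed.

HB.instance Definition _ := isGroup.Build (nonzero D)
  nonzero_mulA nonzero_mul1x nonzero_mulx1 nonzero_mulVx nonzero_mulxV.

End MultiplicativeGroup.

(* Main.v *)
(* Let Z be the center of D.  The last non-abelian term of the derived series of
   the given solvable subgroup is metabelian, so it yields a in N and s in D^*
   which do not commute, and a commutative set A containing a and stable under
   conjugation by s.  For t and u in Z put
     v0 = 1 + u s (t + a)^-1   and   v1 = 1 + u s^-1 (t + s a s^-1)^-1,
   and let x0, x1 be the iterated commutators [a, [a, ..., [a, v_c]]], which lie
   in N when they are long enough.  For suitable t and u, the elements
   g = x0 x1 and a g a^-1 generate a free group.

   Each coefficient of the expansion of a word in powers of u is a sum of terms
   h k(t) with h in D^* normalizing A and k(t) a rational function over the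
   centralizer of A.  The coefficient of u^d has a pole of order at most d at
   t = - a, and its leading coefficient is computed by letting
   a, v0, v1 act on pairs of polynomials as the matrices diag(a, a),
   [[1, 0], [s X, 1]] and [[1, s^-1 X], [0, 1]].  There x0 and x1 become
   unipotent, and a comparison of degrees shows that nontrivial reduced words
   act nontrivially.  Hence each such word differs from 1 for all but finitely
   many t and then for all but finitely many u; as there are only countably many
   words and Z is uncountable, t and u can be chosen for all of them at once. *)
Require Import Defs.
From mathcomp Require Import all_boot all_order all_algebra.
From mathcomp Require Import all_classical.

Set Implicit Arguments.
Unset Strict Implicit.
Unset Printing Implicit Defensive.

Import GRing.Theory.
Local Open Scope classical_set_scope.

(** * Central roots of polynomials *)

Section DivisionRing.
Local Open Scope ring_scope.
Variable D : divRingType.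
Implicit Types (x y z : D) (p q : {poly D}).
Local Notation Z := (ring_center D).

Lemma unitD x : (x \is a GRing.unit) = (x != 0).
Proof.
apply/idP/idP => [xU|/divring_unit //].
by apply/eqP => x0; rewrite x0 unitr0 in xU.
Qed.

Lemma mulVD x : x != 0 -> x^-1 * x = 1.
Proof. by move=> x0; rewrite mulVr ?unitD. Qed.

Lemma mulDV x : x != 0 -> x * x^-1 = 1.
Proof. by move=> x0; rewrite mulrV ?unitD. Qed.

Lemma mulD_eq0 x y : (x * y == 0) = (x == 0) || (y == 0).
Proof.
apply/eqP/orP => [xy0|[/eqP->|/eqP->]]; rewrite ?mul0r ?mulr0 //.
have [_|x0] := eqVneq x 0; first by left.
by right; rewrite -[y]mul1r -(mulVD x0) -mulrA xy0 mulr0.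
Qed.

Lemma center_comm_poly p z : Z z -> comm_poly p z.
Proof. by move=> Zz; exact: Zz. Qed.

Lemma hornerM_center p q z : Z z -> (p * q).[z] = p.[z] * q.[z].
Proof. by move=> Zz; rewrite hornerM_comm //; exact: center_comm_poly. Qed.

(** Evaluation at a central element is multiplicative, so a central root splits off a linear factor
    and the commutative induction on the degree goes through. Noncentral roots can be infinite in
    number. *)
Lemma finite_central_roots p : p != 0 -> finite_set [set z | Z z /\ root p z].
Proof.
have [n] := ubnP (size p); elim: n p => // n IHn p szp p0.
have [[t [Zt pt]]|nort] := pselect (exists t, Z t /\ root p t); last first.
  by apply: sub_finite_set (finite_set0 D) => z Hz; apply: nort; exists z.
have [q pE] := factor_theorem _ _ pt.
have q0 : q != 0 by apply: contra_neq p0; rewrite pE => ->; rewrite mul0r.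
have szq : (size q < n)%N.
  rewrite -ltnS; apply: leq_trans szp; rewrite ltnS pE.
  by rewrite size_Mmonic ?monicXsubC // size_XsubC addn2.
have sub : [set z | Z z /\ root p z] `<=` [set t] `|` [set z | Z z /\ root q z].
  move=> z [Zz]; rewrite pE /root hornerM_center // !hornerE mulD_eq0.
  by move=> /orP[qz|]; [right | rewrite subr_eq0 => /eqP->; left].
by apply: sub_finite_set sub _; rewrite finite_setU; split;
  [exact: finite_set1 | exact: IHn].
Qed.

End DivisionRing.

(** * Expansions of rational functions of a central variable *)

Section Fractions.
Local Open Scope ring_scope.
Variable D : divRingType.
Implicit Types (a c x y z : D) (p q r W : {poly D}) (M : nat).
Local Notation Z := (ring_center D).

Definition eqmX M p q : Prop := exists r, p = q + r * 'X^M.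

Lemma eqmX_mull M (c : {poly D}) p q : eqmX M p q -> eqmX M (c * p) (c * q).
Proof. by move=> [r ->]; exists (c * r); rewrite mulrDr mulrA. Qed.

Lemma eqmX_mulr M (c : {poly D}) p q : eqmX M p q -> eqmX M (p * c) (q * c).
Proof.
by move=> [r ->]; exists (r * c); rewrite mulrDl -!mulrA commr_polyXn.
Qed.

Lemma eqmX_trans M p q r : eqmX M p q -> eqmX M q r -> eqmX M p r.
Proof. by move=> [u ->] [v ->]; exists (v + u); rewrite mulrDl addrA. Qed.

Lemma left_division p a : exists p' c, p = ('X - a%:P) * p' + c%:P.
Proof.
elim/poly_ind: p => [|p c [p' [r ->]]].
  by exists 0, 0; rewrite mulr0 addr0.
exists (p' * 'X + r%:P), (a * r + c).
rewrite mulrDl mulrDr -!mulrA -!addrA; congr (_ + _).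
by rewrite mulrBl -commr_polyX polyCD polyCM addrA subrK.
Qed.

(** An Ore condition: if left division leaves a remainder [c != 0], then
    [c * ('X - c^-1 a c) = ('X - a) * c], so [q = 'X - c^-1 a c] works; [a != 0] keeps its constant
    term nonzero. *)
Lemma ore_XsubC p a : a != 0 ->
  exists p' q, q`_0 != 0 /\ p * q = ('X - a%:P) * p'.
Proof.
move=> a0; have [p' [c ->]] := left_division p a.
have [->|c0] := eqVneq c 0.
  by exists p', 1; rewrite coef1 oner_neq0 addr0 mulr1.
exists (p' * ('X - (c^-1 * a * c)%:P) + c%:P), ('X - (c^-1 * a * c)%:P); split.
  rewrite coefB coefX coefC /= sub0r oppr_eq0 !mulD_eq0 !negb_or c0 a0 !andbT.
  by rewrite -unitD unitrV unitD.
rewrite mulrDl [RHS]mulrDr mulrA; congr (_ + _).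
rewrite mulrBr mulrBl -commr_polyX -!polyCM !mulrA mulDV //.
by rewrite mul1r.
Qed.

Lemma ore_linear p y :
  exists p' q, q`_0 != 0 /\ p * q = (1 + y%:P * 'X) * p'.
Proof.
have [->|y0] := eqVneq y 0.
  by exists p, 1; rewrite coef1 oner_neq0 mul0r addr0 mulr1 mul1r.
have a0 : - y^-1 != 0 by rewrite oppr_eq0 -unitD unitrV unitD.
have [p' [q [q0 pq]]] := ore_XsubC p a0.
exists (y^-1%:P * p'), q; split => //; rewrite pq mulrA; congr (_ * _).
rewrite mulrDl mul1r -mulrA -commr_polyX mulrA -polyCM mulDV // mul1r.
by rewrite polyCN opprK addrC.
Qed.

(** The inverse of [1 + y%:P * 'X] modulo ['X^M], as a truncated geometric series. *)
Definition geom M y : {poly D} := \sum_(i < M) ((- y)%:P * 'X) ^+ i.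

Lemma geom_lin M y : geom M y * (1 + y%:P * 'X) = 1 - ((- y) ^+ M)%:P * 'X^M.
Proof.
have -> : 1 + y%:P * 'X = 1 - (- y)%:P * 'X by rewrite polyCN mulNr opprK.
set t := (- y)%:P * 'X.
have -> : ((- y) ^+ M)%:P * 'X^M = t ^+ M.
  by rewrite exprMn_comm ?polyC_exp //; exact: commr_polyX.
have cM : GRing.comm (geom M y) (1 - t).
  apply: commrB; first exact: commr1.
  by apply: commr_sym; apply: commr_sum => i _; exact: commrX.
rewrite cM -opprB mulNr.
by rewrite -subrX1 opprB.
Qed.

Lemma geom_lin_eqm M y : eqmX M (geom M y * (1 + y%:P * 'X)) 1.
Proof. by exists (- ((- y) ^+ M)%:P); rewrite geom_lin mulNr. Qed.

Lemma lin_geom M y : (1 + y%:P * 'X) * geom M y = 1 - ((- y) ^+ M)%:P * 'X^M.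
Proof.
rewrite -geom_lin /geom.
apply: commr_sum => i _; apply: commrX; apply: commr_sym; apply: commrD;
  first exact: commr1.
by rewrite polyCN mulNr; apply: commr_sym; apply: commrN.
Qed.

(* [phi] is a rational function of a central variable whose expansion at [0]
   is [W] up to order [M]. *)
Definition expands (ok : D -> Prop) M (phi : D -> D) W : Prop :=
  exists p q, [/\ q`_0 != 0, eqmX M (W * q) p &
    forall t, Z t -> ok t -> phi t * q.[t] = p.[t]].

Variables (ok : D -> Prop) (M : nat).

Lemma expands1 : expands ok M (fun=> 1) 1.
Proof.
exists 1, 1; split => [||t _ _]; rewrite ?coef1 ?oner_neq0 ?mulr1 ?hornerC ?mulr1
  //.
by exists 0; rewrite mul0r addr0.
Qed.

Lemma expands_const c phi W :
  expands ok M phi W -> expands ok M (fun t => c * phi t) (c%:P * W).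
Proof.
move=> [p [q [q0 Wq E]]]; exists (c%:P * p), q; split => // [|t Zt okt].
  by rewrite -mulrA; exact: eqmX_mull.
by rewrite -mulrA E // hornerCM.
Qed.

Lemma expands_lin y phi W : expands ok M phi W ->
  expands ok M (fun t => (1 + t * y) * phi t) ((1 + y%:P * 'X) * W).
Proof.
move=> [p [q [q0 Wq E]]]; exists ((1 + y%:P * 'X) * p), q; split => // [|t Zt okt].
  by rewrite -mulrA; exact: eqmX_mull.
by rewrite -mulrA E // hornerM_center // !hornerE Zt.
Qed.

(** The new denominator appears on the left of the fraction [p q^-1]; the Ore condition
    [p q' = (1 + y X) p'] moves it to the right, giving [p' (q q')^-1]. *)
Lemma expands_lin_inv y phi W :
    (forall t, Z t -> ok t -> 1 + t * y != 0) -> expands ok M phi W ->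
  expands ok M (fun t => (1 + t * y)^-1 * phi t) (geom M y * W).
Proof.
move=> ok0 [p [q [q0 Wq E]]].
have [p' [q' [q'0 pq']]] := ore_linear p y.
exists p', (q * q'); split => [||t Zt okt].
- by rewrite coefM big_ord_recl big_ord0 addr0 mulD_eq0 negb_or q0.
- apply: (@eqmX_trans _ _ (geom M y * (p * q'))).
    rewrite -mulrA (mulrA W); apply: eqmX_mull; exact: eqmX_mulr.
  rewrite pq' mulrA -[X in eqmX _ _ X]mul1r.
  by apply: eqmX_mulr; exact: geom_lin_eqm.
rewrite hornerM_center // mulrA -(mulrA _ (phi t)) E // -mulrA -hornerM_center //.
rewrite pq' hornerM_center // hornerD hornerMX !hornerC -Zt mulrA mulVD ?mul1r //.
exact: ok0.
Qed.

(** A polynomial with nonzero constant term is invertible as a power series, so it cancels modulo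
    ['X^M]. *)
Lemma coef_eqmX0 W q d : q`_0 != 0 -> eqmX M (W * q) 0 -> (d < M)%N -> W`_d = 0.
Proof.
move=> q0 [r Wq]; have [n] := ubnP d; elim: n d => // n IHn d dn dM.
have := congr1 (fun p : {poly D} => p`_d) Wq.
rewrite /= add0r coefMXn dM coefM big_ord_recr /= subnn big1 => [|i _].
  by rewrite add0r => /eqP; rewrite mulD_eq0 (negPf q0) orbF => /eqP.
rewrite IHn ?mul0r //; last exact: ltn_trans dM.
by have := ltn_ord i; rewrite ltnS in dn; move=> /leq_trans; apply.
Qed.

(** With [phi = p q^-1] one takes [e = p - q]. If [p = q], cancelling [q] would give [W = 1] modulo
    ['X^M], against the nonzero coefficient in positive degree [d]. *)
Lemma expands_neq1 phi W d : expands ok M phi W -> (0 < d < M)%N -> W`_d != 0 ->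
  exists e : {poly D}, e != 0 /\
    forall t, Z t -> ok t -> phi t = 1 -> root e t.
Proof.
move=> [p [q [q0 Wq E]]] /andP[d0 dM] Wd; exists (p - q); split; last first.
  move=> t Zt okt phi1; have := E t Zt okt; rewrite phi1 mul1r => pq.
  by rewrite /root hornerD hornerN -pq subrr.
apply: contra_neq Wd => /eqP; rewrite subr_eq0 => /eqP pq; move: Wq;
  rewrite pq => -[r Wq].
have := @coef_eqmX0 (W - 1) q d q0; rewrite coefB coef1 (gtn_eqF d0) subr0;
  apply => //.
by exists r; rewrite mulrBl mul1r Wq addrAC subrr.
Qed.

End Fractions.

(** * Leading coefficients at a noncentral pole *)

Section LeadingCoefficients.
Local Open Scope ring_scope.
Variable D : divRingType.
Local Notation Z := (ring_center D).
Variables (a s : D) (A : set D).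
Hypotheses (s_neq0 : s != 0) (Aa : A a).
Hypothesis A_comm : forall b c, A b -> A c -> b * c = c * b.
Hypothesis A_conj : forall b, A b -> A (s^-1 * b * s).
Hypothesis A_conjV : forall b, A b -> A (s * b * s^-1).
Hypothesis sa_neq : s * a <> a * s.
Implicit Types (b c h t x X : D) (F G : D -> D) (l : seq D) (d : nat).

Definition lprod l x : D := \prod_(b <- l) (x + b).

Definition lpoly l : {poly D} := \prod_(b <- l) ('X + b%:P).

(** Makes [lprod l] a denominator that does not vanish at the pole [- a]. *)
Definition avoids l : Prop := forall b, b \in l -> A b /\ b <> a.

Definition centralizes x : Prop := forall b, A b -> x * b = b * x.

Lemma centralizes_center t : Z t -> centralizes t.
Proof. by move=> Zt b _; exact: Zt. Qed.

Lemma centralizesNa : centralizes (- a).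
Proof. by move=> b Ab; rewrite mulNr mulrN A_comm. Qed.

Lemma lprod_comm l x c : avoids l -> centralizes x -> c * x = x * c ->
  (forall b, A b -> c * b = b * c) -> c * lprod l x = lprod l x * c.
Proof.
move=> lA xA cx cA; rewrite /lprod big_seq.
elim/big_ind: _ => [|u v cu cv|b /lA[Ab _]].
- by rewrite mulr1 mul1r.
- by rewrite mulrA cu -mulrA cv mulrA.
- by rewrite mulrDr mulrDl cx cA.
Qed.

Lemma lprod_comm2 l1 l2 x : avoids l1 -> avoids l2 -> centralizes x ->
  lprod l1 x * lprod l2 x = lprod l2 x * lprod l1 x.
Proof.
move=> l1A l2A xA; apply: lprod_comm => // [|b Ab].
  by apply: esym; apply: lprod_comm => // b; exact: xA.
by apply: esym; apply: lprod_comm => // [|c Ac]; [rewrite xA | exact: A_comm].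
Qed.

Lemma lpolyE l x : avoids l -> centralizes x -> (lpoly l).[x] = lprod l x.
Proof.
rewrite /lpoly /lprod; elim: l => [|b l IHl] lA xA;
  first by rewrite !big_nil hornerC.
have lA' : avoids l by move=> c cl; apply: lA; rewrite inE cl orbT.
rewrite !big_cons hornerM_comm ?IHl // ?hornerD ?hornerX ?hornerC //.
by rewrite /comm_poly IHl //; apply: lprod_comm.
Qed.

(** Evaluation at the noncentral point [- a] is not multiplicative in general; here [x] commutes
    with the value of the right factor, which is built from [x] and [A]. *)
Lemma horner_lpoly p l x : avoids l -> centralizes x ->
  (p * lpoly l).[x] = p.[x] * lprod l x.
Proof.
move=> lA xA; rewrite hornerM_comm ?lpolyE //.
by rewrite /comm_poly lpolyE //; apply: lprod_comm.
Qed.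

Lemma lprod_cat l1 l2 x : lprod (l1 ++ l2) x = lprod l1 x * lprod l2 x.
Proof. by rewrite /lprod big_cat. Qed.

Lemma lprodNa_neq0 l : avoids l -> lprod l (- a) != 0.
Proof.
rewrite /lprod => lA; rewrite big_seq.
elim/big_ind: _ => [|u v u0 v0|b /lA[_ ba]].
- exact: oner_neq0.
- by rewrite mulD_eq0 negb_or u0.
- by rewrite addrC subr_eq0; apply/eqP.
Qed.

(* [F] is a rational function of the central variable [t] with a pole of order
   at most [d] at [t = - a], where [(t + a) ^ d F] takes the value [X]. *)
Definition has_lead d F X : Prop :=
  exists l (p : {poly D}), [/\ avoids l,
    forall t, Z t -> F t * (t + a) ^+ d * lprod l t = p.[t]
    & p.[- a] = X * lprod l (- a)].

Lemma has_lead_const d F X c : has_lead d F X ->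
  has_lead d (fun t => c * F t) (c * X).
Proof.
move=> [l [p [lA E Ea]]]; exists l, (c%:P * p); split => // [t Zt|].
  by rewrite -!mulrA (mulrA (F t)) E // hornerCM.
by rewrite hornerCM Ea mulrA.
Qed.

Lemma has_leadD d F G X Y : has_lead d F X -> has_lead d G Y ->
  has_lead d (fun t => F t + G t) (X + Y).
Proof.
move=> [l1 [p1 [l1A E1 E1a]]] [l2 [p2 [l2A E2 E2a]]].
exists (l1 ++ l2), (p1 * lpoly l2 + p2 * lpoly l1); split => [b|t Zt|].
- by rewrite mem_cat => /orP[]; [exact: l1A | exact: l2A].
- have tA := centralizes_center Zt.
  rewrite hornerD !horner_lpoly // lprod_cat !mulrDl -E1 // -E2 // !mulrA.
  by congr (_ + _); rewrite -!mulrA (lprod_comm2 l1A l2A tA).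
have aA := centralizesNa.
rewrite hornerD !horner_lpoly // E1a E2a lprod_cat mulrDl.
by rewrite -!mulrA (lprod_comm2 l2A l1A aA).
Qed.

(** The last condition says that [F t * h^-1] centralizes [A]. Hence moving [F t] to the left of
    [(t + b)^-1] only replaces [b] by [h^-1 b h]. *)
Definition homogeneous h F : Prop :=
  [/\ h != 0, forall b, A b -> A (h^-1 * b * h)
    & forall t b, Z t -> A b -> b * F t = F t * (h^-1 * b * h)].

(** The factor becomes [(t + b')^-1] on the right, with [b' = h^-1 b h]. If [b' = a] the order rises
    and the leading value persists; otherwise [b'] joins the harmless denominator. *)
Lemma homogeneous_pole h F d X b : homogeneous h F -> has_lead d F X -> A b ->
    (forall t, Z t -> t + b != 0) ->
  has_lead d.+1 (fun t => (t + b)^-1 * F t) (if h^-1 * b * h == a then X else 0).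
Proof.
move=> [h0 hA hF] [l [p [lA E Ea]]] Ab b0; set b' := h^-1 * b * h.
have Ab' : A b' by exact: hA.
have tb' t : Z t -> t + b' = h^-1 * (t + b) * h.
  by move=> Zt; rewrite mulrDr mulrDl -Zt -(mulrA t) mulVD ?mulr1.
have b'0 t : Z t -> t + b' != 0.
  move=> Zt; rewrite tb' // !mulD_eq0 !negb_or h0 b0 // !andbT.
  by rewrite -unitD unitrV unitD.
have FE t : Z t -> (t + b)^-1 * F t = F t * (t + b')^-1.
  move=> Zt; have : (t + b) * F t = F t * (t + b') by rewrite mulrDl mulrDr Zt hF.
  move/(congr1 (fun u => (t + b)^-1 * u * (t + b')^-1)).
  by rewrite mulrA mulVD ?b0 // mul1r => ->; rewrite -!mulrA mulDV ?b'0 // mulr1.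
have [b'a|/eqP b'a] := eqVneq b' a.
  exists l, p; split => // t Zt; rewrite FE // -E // b'a exprS.
  by rewrite -!mulrA mulKr // unitD -b'a b'0.
(* Counted at order [d.+1], the numerator gains the factor ['X + a%:P], which vanishes at [- a]. *)
exists (b' :: l), (p * ('X + a%:P)); split => [c|t Zt|].
- by rewrite inE => /orP[/eqP->|/lA//].
- rewrite hornerM_center // hornerD hornerX hornerC -E // FE //.
  have ab' : (t + b') * (t + a) = (t + a) * (t + b').
    by rewrite !mulrDl !mulrDr -!Zt (A_comm Ab' Aa) addrACA.
  have la : lprod l t * (t + a) = (t + a) * lprod l t.
    apply: esym; apply: lprod_comm (centralizes_center Zt) _ _ => // [|c Ac].
      by rewrite -Zt.
    by rewrite mulrDl mulrDr Zt A_comm.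
  have cE : (t + a) ^+ d.+1 * (t + b') = (t + b') * (t + a) ^+ d.+1.
    by apply: esym; apply: commrX.
  rewrite /lprod big_cons -/(lprod l t) mulrA -(mulrA (F t / _)) cE (mulrA (F t /
    _)).
  rewrite -(mulrA (F t)) mulVD ?b'0 // mulr1 -[RHS]mulrA la [RHS]mulrA.
  by rewrite -(mulrA (F t) _ (t + a)) -exprSr.
rewrite mul0r hornerM_comm ?hornerD ?hornerX ?hornerC ?addNr ?mulr0 //.
by rewrite /comm_poly hornerD hornerX hornerC addNr mulr0 mul0r.
Qed.

Lemma homogeneous_mull h F c : c != 0 -> (forall b, A b -> A (c^-1 * b * c)) ->
  homogeneous h F -> homogeneous (c * h) (fun t => c * F t).
Proof.
move=> c0 cA [h0 hA hF].
have cV b : (c * h)^-1 * b * (c * h) = h^-1 * (c^-1 * b * c) * h.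
  by rewrite invrM ?unitD // !mulrA.
split => [|b Ab|t b Zt Ab]; first by rewrite mulD_eq0 negb_or c0.
  by rewrite cV; apply/hA/cA.
rewrite cV -mulrA -hF //; last exact: cA.
by rewrite !mulrA mulDV // mul1r.
Qed.

Lemma has_lead_neq0 d F X : has_lead d F X -> X != 0 ->
  exists e : {poly D}, e != 0 /\ forall t, Z t -> F t = 0 -> root e t.
Proof.
move=> [l [p [lA E Ea]]] X0; exists p; split.
  have pa0 : p.[- a] != 0 by rewrite Ea mulD_eq0 negb_or X0 lprodNa_neq0.
  by apply: contra_neq pa0 => ->; rewrite horner0.
by move=> t Zt Ft; rewrite /root -E // Ft !mul0r.
Qed.

Lemma eq_has_lead d F G X : (forall t, Z t -> F t = G t) ->
  has_lead d F X -> has_lead d G X.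
Proof.
by move=> FG [l [p [lA E Ea]]]; exists l, p; split => // t Zt; rewrite -FG ?E.
Qed.

Lemma homogeneous_comm h F c : centralizes c -> homogeneous h F ->
  homogeneous h (fun t => c * F t).
Proof.
move=> cA [h0 hA hF]; split => [||t b Zt Ab] //.
by rewrite mulrA -cA // -(mulrA c b) hF // mulrA.
Qed.

(* At [t = - a] the operator [t + a] of [D], with [t] acting by right
   multiplication, kills [h] when [h] commutes with [a]; similarly [t + s a s^-1]
   kills [h] when [s^-1 h] commutes with [a].  These are the only two ways in
   which a coefficient can acquire a pole, and [Y0], [Y1] collect the leading
   coefficients of the corresponding components. *)
Definition component h X Y0 Y1 : Prop :=
  [\/ [/\ h * a = a * h, Y0 = X & Y1 = 0],
      [/\ s^-1 * h * a = a * (s^-1 * h), Y0 = 0 & Y1 = X]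
    | [/\ X = 0, Y0 = 0 & Y1 = 0]].

(** The decomposition of [F] into homogeneous components is recorded, not just the total leading
    coefficient, because a further pole acts on each component according to its [h]. *)
Inductive symbol d : (D -> D) -> D -> D -> Prop :=
| symbol_zero F : (forall t, Z t -> F t = 0) -> symbol d F 0 0
| symbol_cons F F1 F2 h X X0 X1 Y0 Y1 :
    homogeneous h F1 -> has_lead d F1 X -> component h X Y0 Y1 ->
    symbol d F2 X0 X1 -> (forall t, Z t -> F t = F1 t + F2 t) ->
    symbol d F (Y0 + X0) (Y1 + X1).

Lemma eq_symbol d F G X0 X1 : (forall t, Z t -> F t = G t) ->
  symbol d F X0 X1 -> symbol d G X0 X1.
Proof.
move=> FG sF; case: sF FG => [F' F0|F' F1 F2 h X X0' X1' Y0 Y1 hom le co sy E] FG.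
  by apply: symbol_zero => t Zt; rewrite -FG ?F0.
by apply: symbol_cons hom le co sy _ => t Zt; rewrite -FG ?E.
Qed.

Lemma symbol_lead d F X0 X1 : symbol d F X0 X1 -> has_lead d F (X0 + X1).
Proof.
elim=> {F X0 X1} [F F0|F F1 F2 h X X0 X1 Y0 Y1 _ le co _ le2 E].
  exists [::], 0; split => // [t Zt|]; rewrite ?F0 ?horner0 ?mul0r //.
  by rewrite addr0 mul0r.
have -> : Y0 + X0 + (Y1 + X1) = X + (X0 + X1).
  by rewrite addrACA; case: co => -[Xe -> ->]; rewrite ?add0r ?addr0 // Xe add0r.
by apply: eq_has_lead _ (has_leadD le le2) => t Zt; rewrite E.
Qed.

Lemma symbolD d F G X0 X1 Y0 Y1 : symbol d F X0 X1 -> symbol d G Y0 Y1 ->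
  symbol d (fun t => F t + G t) (X0 + Y0) (X1 + Y1).
Proof.
move=> symF symG; elim: symF => {F X0 X1} [F F0|F F1 F2 h X X0 X1 Z0 Z1 hom le co _
  IH E].
  by rewrite !add0r; apply: eq_symbol _ symG => t Zt; rewrite F0 ?add0r.
rewrite -!addrA; apply: symbol_cons hom le co IH _ => t Zt.
by rewrite E ?addrA.
Qed.

Lemma symbol_scale d F X0 X1 c : centralizes c -> symbol d F X0 X1 ->
  symbol d (fun t => c * F t) (c * X0) (c * X1).
Proof.
move=> cA; elim=> {F X0 X1} [F F0|F F1 F2 h X X0 X1 Y0 Y1 hom le co _ IH E].
  by rewrite mulr0; apply: symbol_zero => t Zt; rewrite F0 ?mulr0.
rewrite !mulrDr; apply: symbol_cons (homogeneous_comm cA hom) (has_lead_const c le)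
  _ IH _.
  by case: co => -[a0 -> ->]; [apply: Or31|apply: Or32|apply: Or33]; split;
    rewrite ?mulr0 //; rewrite a0 mulr0.
by move=> t Zt; rewrite E ?mulrDr.
Qed.

Lemma addZa_neq0 t : Z t -> t + a != 0.
Proof.
move=> Zt; apply/eqP => /eqP; rewrite addrC addr_eq0 => /eqP aE.
by apply: sa_neq; rewrite aE mulrN mulNr Zt.
Qed.

Lemma addZsa_neq0 t : Z t -> t + s * a * s^-1 != 0.
Proof.
move=> Zt; have -> : t + s * a * s^-1 = s * (t + a) * s^-1.
  by rewrite mulrDr mulrDl -Zt -(mulrA t) mulDV ?mulr1.
by rewrite !mulD_eq0 !negb_or s_neq0 addZa_neq0 //= -unitD unitrV unitD.
Qed.

(** Otherwise [s^-1 = (s^-1 h) h^-1] would commute with [a]. Thus each of the two poles sees only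
    one kind of component. *)
Lemma component_excl h : h != 0 -> h * a = a * h ->
  s^-1 * h * a = a * (s^-1 * h) -> False.
Proof.
move=> h0 ha E; have : s^-1 * a * h = a * s^-1 * h.
  by rewrite -mulrA -ha mulrA E mulrA.
move/(congr1 ( *%R^~ h^-1)); rewrite !mulrK ?unitD // => /(congr1 (fun u => s * u *
  s)).
rewrite !mulrA mulDV // mul1r -(mulrA _ s^-1) mulVD // mulr1 => /esym;
  exact: sa_neq.
Qed.

Lemma conj_eq (h x y : D) : h != 0 -> (h^-1 * x * h == y) = (x * h == h * y).
Proof.
move=> h0; apply/eqP/eqP => [<-|E]; first by rewrite !mulrA mulDV ?mul1r.
by rewrite -mulrA E mulrA mulVD ?mul1r.
Qed.

Lemma homogeneous_centerinv h F b : homogeneous h F -> A b ->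
  (forall t, Z t -> t + b != 0) -> homogeneous h (fun t => (t + b)^-1 * F t).
Proof.
move=> [h0 hA hF] Ab b0; split => [||t c Zt Ac] //.
have cb : c * (t + b)^-1 = (t + b)^-1 * c.
  by apply: commrV; rewrite /GRing.comm mulrDl mulrDr Zt (A_comm Ac Ab).
by rewrite mulrA cb -(mulrA _ c) hF // mulrA.
Qed.

(** The pole at [- a] survives exactly on components whose [h] commutes with [a]; multiplying by [s]
    turns [h] into [s h], of the second kind. *)
Lemma symbol_y1 d F X0 X1 : symbol d F X0 X1 ->
  symbol d.+1 (fun t => s * ((t + a)^-1 * F t)) 0 (s * X0).
Proof.
elim=> {F X0 X1} [F F0|F F1 F2 h X X0 X1 Y0 Y1 hom le co _ IH E].
  by rewrite mulr0; apply: symbol_zero => t Zt; rewrite F0 // !mulr0.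
have [h0 _ _] := hom.
have le' := has_lead_const s (homogeneous_pole hom le Aa addZa_neq0).
have hom' := homogeneous_mull s_neq0 A_conj (homogeneous_centerinv hom Aa
  addZa_neq0).
have -> : 0 = 0 + 0 :> D by rewrite addr0.
rewrite mulrDr; apply: symbol_cons hom' le' _ IH _ => [|t Zt]; last first.
  by rewrite E // !mulrDr.
rewrite conj_eq //.
case: co => -[H -> _].
- rewrite H eqxx; apply: Or32; split => //.
  by rewrite mulrA mulVD ?mul1r.
- rewrite ifN; first by apply: Or33; rewrite mulr0.
  by apply/eqP => /esym ha; apply: (component_excl h0 ha).
- by apply: Or33; rewrite H if_same !mulr0.
Qed.

(** Here [h^-1 (s a s^-1) h = a] means that [s^-1 h] commutes with [a], so the second kind survives
    and [s^-1] carries it to the first. *)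
Lemma symbol_y2 d F X0 X1 : symbol d F X0 X1 ->
  symbol d.+1 (fun t => s^-1 * ((t + s * a * s^-1)^-1 * F t)) (s^-1 * X1) 0.
Proof.
have sV0 : s^-1 != 0 by rewrite -unitD unitrV unitD.
have Asa := A_conjV Aa.
elim=> {F X0 X1} [F F0|F F1 F2 h X X0 X1 Y0 Y1 hom le co _ IH E].
  by rewrite mulr0; apply: symbol_zero => t Zt; rewrite F0 // !mulr0.
have [h0 _ _] := hom.
have le' := has_lead_const s^-1 (homogeneous_pole hom le Asa addZsa_neq0).
have sVA b : A b -> A (s^-1^-1 * b * s^-1) by rewrite invrK; exact: A_conjV.
have hom' := homogeneous_mull sV0 sVA (homogeneous_centerinv hom Asa addZsa_neq0).
have -> : 0 = 0 + 0 :> D by rewrite addr0.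
rewrite mulrDr; apply: symbol_cons hom' le' _ IH _ => [|t Zt]; last first.
  by rewrite E // !mulrDr.
have sE : (s * a * s^-1 * h == h * a) = (a * (s^-1 * h) == s^-1 * h * a).
  apply/eqP/eqP => [/(congr1 ( *%R s^-1))|/(congr1 ( *%R s))].
    by rewrite !mulrA mulVD // mul1r.
  by rewrite !mulrA mulDV // mul1r.
rewrite conj_eq // sE.
case: co => -[H _ ->].
- rewrite ifN; first by apply: Or33; rewrite !mulr0.
  by apply/eqP => /esym ha; apply: (component_excl h0 H ha).
- by rewrite H eqxx; apply: Or31.
- by apply: Or33; rewrite H if_same !mulr0.
Qed.

End LeadingCoefficients.

(** * Words acting on pairs of polynomials *)

(* [None] stands for [a], [Some false] for [v0] and [Some true] for [v1]; the
   second component is the sign of the exponent. *)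
Definition gen : Type := (option bool * bool)%type.

Definition winv (w : seq gen) : seq gen := rev [seq (x.1, ~~ x.2) | x <- w].

Lemma winv_cat u v : winv (u ++ v) = winv v ++ winv u.
Proof. by rewrite /winv map_cat rev_cat. Qed.

Lemma winvK : involutive winv.
Proof.
move=> w; rewrite /winv map_rev revK -map_comp map_id_in // => -[x b] _ /=.
by rewrite negbK.
Qed.

Fixpoint comm_word (c : bool) n : seq gen :=
  if n is n'.+1 then
    (None, true) :: comm_word c n' ++ (None, false) :: winv (comm_word c n')
  else [:: (Some c, true)].

Definition basis_word n (e : bool) : seq gen :=
  if e then [:: (None, true)] ++ (comm_word false n ++ comm_word true n) ++ [::
    (None, false)]
  else comm_word false n ++ comm_word true n.

Definition signed_word n (x : bool * bool) : seq gen :=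
  if x.2 then basis_word n x.1 else winv (basis_word n x.1).

Definition expand_word n (w : seq (bool * bool)) : seq gen :=
  flatten [seq signed_word n x | x <- w].

Definition reduced2 (w : seq (bool * bool)) : bool :=
  sorted (fun x y => ~~ ((x.1 == y.1) && (x.2 != y.2))) w.

Definition base (D : divRingType) (s : D) (c : bool) : D := if c then s^-1%R else s.

Section SymbolAction.
Local Open Scope ring_scope.
Variable D : divRingType.
Variables a s : D.
Hypotheses (a_neq0 : a != 0) (s_neq0 : s != 0).
Hypothesis base_comm : forall c, (base s c)^-1 * a * base s c * a = a * ((base s
  c)^-1 * a * base s c).
Hypothesis sa_neq : s * a <> a * s.
Implicit Types (z : D) (P : {poly D} * {poly D}) (p q r : {poly D}).

(** The elementary matrix with off-diagonal entry [z X], upper triangular for [c = true] and lower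
    triangular for [c = false], acting on columns. *)
Definition elem (c : bool) z P : {poly D} * {poly D} :=
  if c then (P.1 + z%:P * 'X * P.2, P.2) else (P.1, P.2 + z%:P * 'X * P.1).

Definition scal z P : {poly D} * {poly D} := (z%:P * P.1, z%:P * P.2).

#[local] Arguments elem : simpl never.
#[local] Arguments scal : simpl never.

Definition gen_act (x : gen) P : {poly D} * {poly D} :=
  match x with
  | (None, b) => scal (if b then a else a^-1) P
  | (Some c, b) => elem c (if b then base s c else - base s c) P
  end.

Definition word_act w P := foldr gen_act P w.

Lemma word_act_cat u v P : word_act (u ++ v) P = word_act u (word_act v P).
Proof. exact: foldr_cat. Qed.

Lemma elemD c z z' P : elem c z (elem c z' P) = elem c (z + z') P.
Proof.
by case: c; rewrite /elem /= polyCD !mulrDl -addrA; congr (_, _); congr (_ + _);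
  exact: addrC.
Qed.

Lemma elem_conj c z P : scal a (elem c z (scal a^-1 P)) = elem c (a * z * a^-1) P.
Proof.
have aK p : a%:P * (a^-1%:P * p) = p by rewrite mulrA -polyCM mulDV // mul1r.
have azK p : a%:P * (z%:P * 'X * (a^-1%:P * p)) = (a * z * a^-1)%:P * 'X * p.
  by rewrite !polyCM -!mulrA (mulrA 'X) -commr_polyX -mulrA.
by case: c; rewrite /elem /scal /= mulrDr !aK azK.
Qed.

Fixpoint comm_coef c n : D :=
  if n is n'.+1 then a * comm_coef c n' * a^-1 - comm_coef c n' else base s c.

(** Elementary matrices of one type add their entries, and conjugation by the scalar [a] conjugates
    the entry, so commutation with [a] turns [z] into [a z a^-1 - z]. *)
Lemma comm_word_act c n P :
  word_act (comm_word c n) P = elem c (comm_coef c n) P /\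
  word_act (winv (comm_word c n)) P = elem c (- comm_coef c n) P.
Proof.
elim: n P => [|n IHn] P //=.
have act1 Q : word_act (comm_word c n) Q = elem c (comm_coef c n) Q by case: (IHn
  Q).
have act2 Q : word_act (winv (comm_word c n)) Q = elem c (- comm_coef c n) Q by
  case: (IHn Q).
split.
  by rewrite word_act_cat /= act2 act1 elem_conj elemD.
rewrite -cat1s winv_cat winv_cat -(cat1s _ (winv _)) winv_cat winvK !word_act_cat
  /=.
by rewrite act2 act1 elem_conj elemD mulrN mulNr opprB.
Qed.

Lemma base_neq0 c : base s c != 0.
Proof. by case: c => //=; rewrite -unitD unitrV unitD. Qed.

Lemma base_conj_neq c : (base s c)^-1 * a * base s c <> a.
Proof.
move/(congr1 ( *%R (base s c))); rewrite !mulrA mulDV ?base_neq0 // mul1r.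
case: c => [|/esym]; last exact: sa_neq.
move/(congr1 (fun u => s * u * s)); rewrite /base /= -!mulrA mulVD // mulr1 !mulrA
  mulDV // mul1r.
exact: sa_neq.
Qed.

(** As [a] commutes with its conjugate by [base s c], it commutes with [m], and each commutation
    contributes one factor [m]. Since [m != 0], the entries never vanish. *)
Lemma comm_coefE c n : let m := (base s c)^-1 * a * base s c * a^-1 - 1 in
  comm_coef c n = base s c * m ^+ n.
Proof.
move=> m; elim: n => [|n /= ->]; first by rewrite expr0 mulr1.
have am : GRing.comm a m.
  apply: commrB; last exact: commr1.
  by apply: commrM; [exact/esym/base_comm | exact/commrV/commr_refl].
have amn : m ^+ n * a^-1 = a^-1 * m ^+ n.
  by apply: commrV; apply: commr_sym; apply: commrX.
rewrite exprS -!mulrA amn !mulrA.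
have -> : a * base s c = base s c * ((base s c)^-1 * a * base s c).
  by rewrite !mulrA mulDV ?mul1r ?base_neq0.
by rewrite /m !(mulrBr, mulrBl) mulr1 !mulrA.
Qed.

Lemma comm_coef_neq0 c n : comm_coef c n != 0.
Proof.
rewrite comm_coefE mulD_eq0 negb_or base_neq0 /=.
have m0 : (base s c)^-1 * a * base s c * a^-1 - 1 != 0.
  rewrite subr_eq0; apply/eqP => /(congr1 ( *%R^~ a)).
  by rewrite -(mulrA _ a^-1) mulVD // mulr1 mul1r; exact: base_conj_neq.
by elim: n => [|n IHn]; rewrite ?oner_neq0 // exprS mulD_eq0 negb_or m0.
Qed.

Variable n : nat.

Definition basis_coef (c e : bool) : D :=
  if e then a * comm_coef c n * a^-1 else comm_coef c n.

Lemma basis_coef_neq0 c e : basis_coef c e != 0.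
Proof.
by case: e; rewrite /= ?mulD_eq0 ?negb_or ?a_neq0 comm_coef_neq0 //= -unitD unitrV
  unitD.
Qed.

Lemma basis_coef_neq c e f : e != f -> basis_coef c e - basis_coef c f != 0.
Proof.
have := comm_coef_neq0 c n.+1; rewrite /= => dz.
by case: e f => [] [] //= _; rewrite // -opprB oppr_eq0.
Qed.

Lemma basis_word_act e P :
  word_act (basis_word n e) P =
    elem false (basis_coef false e) (elem true (basis_coef true e) P) /\
  word_act (winv (basis_word n e)) P =
    elem true (- basis_coef true e) (elem false (- basis_coef false e) P).
Proof.
have a1 c Q : word_act (comm_word c n) Q = elem c (comm_coef c n) Q.
  by case: (comm_word_act c n Q).
have a2 c Q : word_act (winv (comm_word c n)) Q = elem c (- comm_coef c n) Q.
  by case: (comm_word_act c n Q).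
have aK Q : scal a^-1 (scal a Q) = Q.
  case: Q => p q; rewrite /scal /=.
  by congr (_, _); rewrite mulrA -polyCM mulVD // mul1r.
case: e; rewrite /basis_word /basis_coef; last first.
  by rewrite winv_cat !word_act_cat !a1 !a2.
rewrite !winv_cat !word_act_cat /= !a1 !a2.
have aN z : - (a * z * a^-1) = a * (- z) * a^-1 by rewrite mulrN mulNr.
by split; rewrite ?aN -!elem_conj aK.
Qed.

(* The ping-pong invariant.  The last letter applied is a basis word [e] ([b] is
   true) or its inverse ([b] is false); keeping track of [e] shows that a next
   letter that does not cancel with it cannot lower the degree. *)
Definition dominated (e b : bool) P : Prop := exists p q, [/\ (size q < size p)%N &
  P = if b then (p, q + (basis_coef false e)%:P * 'X * p)
      else (q - (basis_coef true e)%:P * 'X * p, p)].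

Lemma size_raise z p q : z != 0 -> (size q <= size p)%N -> p != 0 ->
  size (q + z%:P * 'X * p) = (size p).+1.
Proof.
move=> z0 qp p0; have szp : size (z%:P * 'X * p) = (size p).+1.
  rewrite -mulrA -commr_polyX mul_polyC lreg_size ?size_mulX //.
  by apply: mulrI; rewrite unitD.
by rewrite addrC size_polyDl szp.
Qed.

(** For equal signs both elementary factors of the new letter raise the degree. For opposite signs
    its first factor merges with the last one applied; then [e != f], so the merged entry is a
    nonzero difference and the degree does not drop. *)
Lemma dominated_step x y P : ~~ ((x.1 == y.1) && (x.2 != y.2)) ->
  dominated y.1 y.2 P -> dominated x.1 x.2 (word_act (signed_word n x) P).
Proof.
case: x y => [e b] [f c] /= red [p [q [qp ->]]].
have p0 : p != 0 by rewrite -size_poly_gt0 (leq_ltn_trans _ qp).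
have z0 := basis_coef_neq0; have zN c' e' : - basis_coef c' e' != 0 by rewrite
  oppr_eq0.
have eNp z r : r - z%:P * 'X * p = r + (- z)%:P * 'X * p by rewrite polyCN !mulNr.
have tail z r r' : z != 0 -> (size r < size r')%N ->
    (size r' < size (r + z%:P * 'X * r')%R)%N.
  by move=> ? rr'; rewrite size_raise ?ltnS // ?(ltnW rr') // -size_poly_gt0
    (leq_ltn_trans _ rr').
rewrite /signed_word /=; case: b red => red.
  rewrite (proj1 (basis_word_act e _)) /elem /=; case: c red => red /=.
    eexists; eexists; split; last by congr (_, _).
    apply: (tail) => //; exact: tail.
  have ef : e != f by move: red; rewrite andbT.
  have -> : q - (basis_coef true f)%:P * 'X * p + (basis_coef true e)%:P * 'X * p
          = q + (basis_coef true e - basis_coef true f)%:P * 'X * p.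
    by rewrite polyCB !mulrBl -addrA; congr (_ + _); exact: addrC.
  eexists; eexists; split; last by congr (_, _).
  by apply: tail => //; exact: basis_coef_neq.
rewrite (proj2 (basis_word_act e _)) /elem /=; case: c red => red /=.
  have ef : e != f by move: red; rewrite andbT.
  have -> : q + (basis_coef false f)%:P * 'X * p + (- basis_coef false e)%:P * 'X *
    p
          = q + (basis_coef false f - basis_coef false e)%:P * 'X * p.
    by rewrite polyCB polyCN !mulrBl mulNr addrA mulNr.
  eexists; eexists; split; last by rewrite polyCN !mulNr.
  by apply: tail => //; apply: basis_coef_neq; rewrite eq_sym.
eexists; eexists; split; last by rewrite [in LHS]polyCN !mulNr.
by rewrite eNp; apply: (tail) => //; apply: tail.
Qed.

Lemma dominated_start x : dominated x.1 x.2 (word_act (signed_word n x) (1, 0)).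
Proof.
case: x => e [] /=; rewrite /signed_word /=.
  rewrite (proj1 (basis_word_act e _)) /elem /= mulr0 addr0.
  by exists 1, 0; rewrite size_poly0 size_poly1.
rewrite (proj2 (basis_word_act e _)) /elem /= add0r mulr1.
eexists; exists 1; split; last by rewrite [X in (_ + X * _ * _, _)]polyCN !mulNr.
rewrite size_poly1 size_mulX ?polyC_eq0 ?oppr_eq0 ?basis_coef_neq0 //.
by rewrite size_polyC oppr_eq0 basis_coef_neq0.
Qed.

Lemma reduced_act w : reduced2 w -> w <> [::] ->
  exists e b, dominated e b (word_act (expand_word n w) (1, 0)).
Proof.
case: w => // x w red _; exists x.1, x.2.
elim: w x red => [|y w IHw] x; first by move=> _; rewrite /expand_word /= cats0;
  exact: dominated_start.
rewrite /reduced2 /= => /andP[xy /IHw dom].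
by rewrite /expand_word /= word_act_cat; exact: dominated_step xy dom.
Qed.

Lemma dominated_coef e b P : dominated e b P ->
  exists2 d, (0 < d)%N & P.1`_d + P.2`_d != 0.
Proof.
move=> [p [q [qp ->]]].
have p0 : p != 0 by rewrite -size_poly_gt0 (leq_ltn_trans _ qp).
(* This is the degree of the larger entry and exceeds that of the other, so nothing cancels in the
   sum. *)
exists (size p); first by rewrite size_poly_gt0.
have top z : z != 0 -> (q + z%:P * 'X * p)`_(size p) != 0.
  move=> z0; have := size_raise z0 (ltnW qp) p0 => szE.
  have : lead_coef (q + z%:P * 'X * p) != 0 by rewrite lead_coef_eq0 -size_poly_gt0
    szE.
  by rewrite lead_coefE szE.
case: b => /=; rewrite [p`_(size p)]nth_default // ?add0r ?addr0.
  exact: top (basis_coef_neq0 _ _).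
by rewrite -mulNr -mulNr -polyCN; apply: top; rewrite oppr_eq0 basis_coef_neq0.
Qed.

End SymbolAction.

(** * Generic values of words *)

Section GenericWords.
Local Open Scope ring_scope.
Variable D : divRingType.
Local Notation Z := (ring_center D).
Variables (a s : D) (A : set D).
Hypotheses (a_neq0 : a != 0) (s_neq0 : s != 0) (Aa : A a).
Hypothesis A_comm : forall b c, A b -> A c -> b * c = c * b.
Hypothesis A_conj : forall b, A b -> A (s^-1 * b * s).
Hypothesis A_conjV : forall b, A b -> A (s * b * s^-1).
Hypothesis sa_neq : s * a <> a * s.
Implicit Types (t u : D) (W : D -> {poly D}) (P : {poly D} * {poly D}).

Definition pole (c : bool) t : D :=
  if c then s^-1 * (t + s * a * s^-1)^-1 else s * (t + a)^-1.

Definition gen_poly M t (x : gen) : {poly D} :=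
  match x with
  | (None, b) => (if b then a else a^-1)%:P
  | (Some c, b) => if b then 1 + (pole c t)%:P * 'X else geom M (pole c t)
  end.

Definition gen_val t u (x : gen) : D :=
  match x with
  | (None, b) => if b then a else a^-1
  | (Some c, b) => if b then 1 + u * pole c t else (1 + u * pole c t)^-1
  end.

Definition word_poly M t (w : seq gen) : {poly D} := \prod_(x <- w) gen_poly M t x.

Definition word_eval t u (w : seq gen) : D := \prod_(x <- w) gen_val t u x.

Definition admissible t u : Prop := forall c, 1 + u * pole c t != 0.

(** Here [t] is fixed and the central variable of the expansion is [u]. *)
Lemma word_expands M t w :
  expands (admissible t) M (word_eval t ^~ w) (word_poly M t w).
Proof.
rewrite /word_eval /word_poly; elim: w => [|[[c|] b] w IHw].
- rewrite big_nil; under [X in expands _ _ X _]funext do rewrite big_nil.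
  exact: expands1.
- rewrite big_cons; under [X in expands _ _ X _]funext do rewrite big_cons.
  case: b => /=; first exact: expands_lin.
  by apply: expands_lin_inv => // u _; apply.
- rewrite big_cons; under [X in expands _ _ X _]funext do rewrite big_cons.
  exact: expands_const.
Qed.

(** Now [t] varies: the coefficient of [u^d] is matched at pole order [d] with the degree [d]
    coefficients of the pair [P]. *)
Definition symbol_upto M W (P : {poly D} * {poly D}) : Prop :=
  forall d, (d < M)%N -> symbol a s A d (fun t => (W t)`_d) P.1`_d P.2`_d.

Lemma pole_symbol c d F X0 X1 : symbol a s A d F X0 X1 ->
  symbol a s A d.+1 (fun t => pole c t * F t)
    (if c then base s c * X1 else 0) (if c then 0 else base s c * X0).
Proof.
move=> sF; case: c => /=.
  by apply: eq_symbol _ (symbol_y2 s_neq0 Aa A_comm A_conjV sa_neq sF) => t _;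
    rewrite mulrA.
by apply: eq_symbol _ (symbol_y1 s_neq0 Aa A_comm A_conj sa_neq sF) => t _;
  rewrite mulrA.
Qed.

Lemma symbol_coef_shift c W P d :
  (forall d', (d' < d)%N -> symbol a s A d' (fun t => (W t)`_d') P.1`_d' P.2`_d') ->
  symbol a s A d (fun t => if d is d'.+1 then pole c t * (W t)`_d' else 0)
    (if c then (base s c)%:P * 'X * P.2 else 0)`_d
    (if c then 0 else (base s c)%:P * 'X * P.1)`_d.
Proof.
case: d => [|d] sW.
  have X0 z (q : {poly D}) : (z%:P * 'X * q)`_0 = 0.
    by rewrite -mulrA coefCM coefXM mulr0.
  by case: c; rewrite !(X0, coef0); exact: symbol_zero.
have XS z (q : {poly D}) : (z%:P * 'X * q)`_d.+1 = z * q`_d.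
  by rewrite -mulrA coefCM coefXM.
have := pole_symbol c (sW d (ltnSn d)).
by case: c; rewrite /= !(XS, coef0).
Qed.

Lemma coef_lin y (p : {poly D}) d :
  ((1 + y%:P * 'X) * p)`_d = p`_d + (if d is d'.+1 then y * p`_d' else 0).
Proof.
rewrite mulrDl mul1r coefD -mulrA coefCM coefXM.
by case: d => [|d] //=; rewrite mulr0.
Qed.

Lemma gen_symbol M x W P : symbol_upto M W P ->
  symbol_upto M (fun t => gen_poly M t x * W t) (gen_act a s x P).
Proof.
case: x => [[c|] b] sW d dM /=; last first.
  rewrite !coefCM.
  have cA : centralizes A (if b then a else a^-1).
    move=> z Az; case: b; first exact: A_comm.
    by apply: esym; apply: commrV; exact: A_comm.
  by apply: eq_symbol _ (symbol_scale cA (sW d dM)) => t _; rewrite coefCM.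
have NC : centralizes A (-1) by move=> z _; rewrite mulN1r mulrN1.
case: b.
  have sd := symbol_coef_shift c (fun d' d'd => sW d' (ltn_trans d'd dM)).
  have := symbolD (sW d dM) sd.
  rewrite /elem; case: (c) => /= H; rewrite !coefD ?coef0 ?addr0 in H *;
    by apply: eq_symbol _ H => t _; rewrite coef_lin.
(* For an inverse letter with pole [y], the product [V] of [geom] and [W] satisfies
   [V_d = W_d - y V_(d-1)] for [d < M], and [elem] with entry [- base s c] obeys the matching
   recursion. *)
elim/ltn_ind: d dM => d IHd dM.
have sV d' : (d' < d)%N -> symbol a s A d' (fun t => (geom M (pole c t) * W t)`_d')
    (elem c (- base s c) P).1`_d' (elem c (- base s c) P).2`_d'.
  by move=> d'd; apply: IHd => //; exact: ltn_trans dM.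
have sd := symbol_scale NC (symbol_coef_shift c sV).
have VE t : (geom M (pole c t) * W t)`_d = (W t)`_d +
    -1 * (if d is d'.+1 then pole c t * (geom M (pole c t) * W t)`_d' else 0).
  apply/eqP; rewrite mulN1r eq_sym subr_eq -coef_lin mulrA lin_geom mulrBl mul1r
    coefB.
  by rewrite -mulrA -commr_polyXn mulrA coefMXn dM subr0.
move: VE (symbolD (sW d dM) sd); rewrite /elem; case: (c) => /= VE H;
  rewrite !mulN1r ?coef0 ?oppr0 ?addr0 in H; rewrite coefD polyCN !mulNr coefN;
  by apply: eq_symbol _ H => t _; rewrite VE.
Qed.

Lemma word_symbol M w : symbol_upto M (word_poly M ^~ w) (word_act a s w (1, 0)).
Proof.
rewrite /word_poly; elim: w => [|x w IHw] d dM.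
  rewrite /= coef1 coef0.
  apply: (@eq_symbol _ _ _ _ _ (fun=> (d == 0)%N%:R)).
    by move=> t _; rewrite big_nil coef1.
  case: d dM => [|d] _ /=; last exact: symbol_zero.
  (* The constant 1 is a component with [h = 1], which commutes with [a]; hence the initial pair
     [(1, 0)]. *)
  have h1 : homogeneous A 1 (fun=> 1 : D).
    by split => [|b Ab|t b Zt Ab]; rewrite ?oner_neq0 ?invr1 ?mul1r ?mulr1.
  have l1 : has_lead a A 0 (fun=> 1) 1.
    by exists [::], 1; split => // *; rewrite hornerC /lprod big_nil ?expr0 ?mul1r.
  have c1 : component a s 1 1 1 0 by apply: Or31; rewrite mul1r mulr1.
  have s0 : symbol a s A 0 (fun=> 0) 0 0 by exact: symbol_zero.
  have := @symbol_cons _ _ _ _ _ (fun=> 1) _ _ _ _ _ _ _ _ h1 l1 c1 s0.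
  by rewrite !addr0; apply.
have := gen_symbol x IHw dM.
by apply: eq_symbol => t _; rewrite big_cons.
Qed.

(** A nonzero leading coefficient at [t = - a] makes the coefficient of [u^d] nonzero off the roots
    of [e]; for such a [t], this coefficient in positive degree separates the word from 1 off the
    roots of an [e'] depending on [t]. *)
Lemma generic_word n (w : seq (bool * bool)) : reduced2 w -> w <> [::] ->
  exists2 e : {poly D}, e != 0 & forall t, Z t -> ~~ root e t ->
    exists2 e' : {poly D}, e' != 0 & forall u, Z u -> admissible t u ->
      word_eval t u (expand_word n w) = 1 -> root e' u.
Proof.
move=> red w0.
have base_comm c : (base s c)^-1 * a * base s c * a = a * ((base s c)^-1 * a * base
  s c).
  by apply: A_comm => //; case: c; rewrite /= ?invrK;
    [exact: A_conjV | exact: A_conj].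
have [e0 [b dom]] := reduced_act a_neq0 s_neq0 base_comm sa_neq n red w0.
have [d d0 Xd] := dominated_coef a_neq0 s_neq0 base_comm sa_neq dom.
have sym := word_symbol (expand_word n w) (ltnSn d).
have le := symbol_lead Aa A_comm sym.
have [e [e_neq0 eP]] := has_lead_neq0 le Xd.
exists e => // t Zt et.
have Wd : (word_poly d.+1 t (expand_word n w))`_d != 0.
  by apply: contraNneq et => /(eP _ Zt).
have [|e' [e'0 e'P]] := expands_neq1 (word_expands d.+1 t _) _ Wd.
  by rewrite d0 ltnSn.
by exists e'.
Qed.

Hypothesis hZ : ~ countable Z.

Lemma generic_center (I : countType) (e : I -> {poly D}) : (forall i, e i != 0) ->
  exists2 t, Z t & forall i, ~~ root (e i) t.
Proof.
move=> e0; apply: contrapT => no; apply: hZ.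
have sub : Z `<=` \bigcup_(i in [set: I]) [set z | Z z /\ root (e i) z].
  move=> t Zt; apply: contrapT => nt; apply: no; exists t => // i.
  by apply/negP => ri; apply: nt; exists i.
apply: sub_countable (subset_card_le sub) _.
apply: bigcup_countable => // i _.
by apply: finite_set_countable; exact: finite_central_roots.
Qed.

Lemma generic_parameters n : exists t u, [/\ Z t, Z u, admissible t u &
  forall w : seq (bool * bool), reduced2 w -> w <> [::] ->
    word_eval t u (expand_word n w) <> 1].
Proof.
have /choice[e eP] : forall w : seq (bool * bool), exists e : {poly D}, e != 0 /\
    (reduced2 w -> w <> [::] -> forall t, Z t -> ~~ root e t ->
    exists2 e' : {poly D}, e' != 0 & forall u, Z u -> admissible t u ->
      word_eval t u (expand_word n w) = 1 -> root e' u).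
  move=> w; have [[red w0]|nw] := pselect (reduced2 w /\ w <> [::]).
    by have [e e0 eP] := generic_word n red w0; exists e.
  (* Words that impose no condition get the constant polynomial 1, which has no roots. *)
  by exists 1; split; [exact: oner_neq0 | move=> red w0; case: nw].
have [t Zt te] := generic_center (fun w => (eP w).1).
have /choice[f fP] : forall w : seq (bool * bool), exists e : {poly D}, e != 0 /\
    (reduced2 w -> w <> [::] -> forall u, Z u -> admissible t u ->
      word_eval t u (expand_word n w) = 1 -> root e u).
  move=> w; have [[red w0]|nw] := pselect (reduced2 w /\ w <> [::]).
    by have [e' e'0 e'P] := (eP w).2 red w0 t Zt (te w); exists e'.
  by exists 1; split; [exact: oner_neq0 | move=> red w0; case: nw].
pose lin c : {poly D} := 1 + (pole c t)%:P * 'X.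
have lin0 c : lin c != 0.
  apply/eqP => /(congr1 (fun p : {poly D} => p`_0));
    rewrite coefD coef1 coefCM coefX.
  by rewrite mulr0 addr0 coef0; apply/eqP; exact: oner_neq0.
(* The summand [bool] makes [v0] and [v1] nonzero; the other one handles all words at once. *)
have [|u Zu ue] := @generic_center (bool + seq (bool * bool))%type
    (fun i => match i with inl c => lin c | inr w => f w end).
  by case=> [c|w]; [exact: lin0 | exact: (fP w).1].
have adm : admissible t u.
  move=> c; have := ue (inl c); apply: contraNneq.
  by rewrite /root hornerD hornerMX !hornerC -Zu => ->.
exists t, u; split => // w red w0 wu.
by have := ue (inr w); rewrite ((fP w).2 red w0 u Zu adm wu).
Qed.

End GenericWords.

(** * Subgroups *)

Section Subgroups.
Local Open Scope group_scope.
Variable G : groupType.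
Implicit Types (x y z : G) (H K S X : set G).

Lemma subgroupP H : is_subgroup H <->
  [/\ H 1, forall x y, H x -> H y -> H (x * y) & forall x, H x -> H x^-1].
Proof.
split=> [hH|[H1 HM HV]].
  split=> [|x y Hx Hy|x Hx].
  - by have := hH.1; rewrite inE.
  - by have := group_closedM hH (mem_set Hx) (mem_set Hy); rewrite inE.
  - by have := group_closedV hH (mem_set Hx); rewrite inE.
split; first exact: mem_set.
by move=> x y /set_mem Hx /set_mem Hy; apply: mem_set; apply: HM => //; exact: HV.
Qed.

Lemma generated_sub X : X `<=` generated X.
Proof. exact: sub_smallest. Qed.

Lemma generated_min X H : is_subgroup H -> X `<=` H -> generated X `<=` H.
Proof. by move=> hH XH; apply: smallest_sub. Qed.

Lemma generated_subgroup X : is_subgroup (generated X).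
Proof.
apply/subgroupP; split=> [K [/subgroupP[]] //|x y gx gy K|x gx K] [hK XK].
  have [_ KM _] := (subgroupP K).1 hK.
  by apply: KM; [exact: gx | exact: gy].
have [_ _ KV] := (subgroupP K).1 hK.
by apply: KV; exact: gx.
Qed.

Lemma derived_sub H : is_subgroup H -> derived H `<=` H.
Proof.
move=> hH; have [_ HM HV] := (subgroupP H).1 hH.
apply: generated_min => // z [x [y [Hx Hy ->]]]; rewrite commgEl conjgE.
by apply: (HM); [exact: HV | apply: (HM); [exact: HV | exact: HM]].
Qed.

Lemma conjg_commg x y : x ^ y = x * [~ x, y].
Proof. by rewrite commgEl mulVKg. Qed.

Lemma derived_commg H x y : H x -> H y -> derived H [~ x, y].
Proof. by move=> Hx Hy; apply: generated_sub; exists x, y. Qed.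

Lemma solvable_metabelian S : is_subgroup S -> is_solvable S -> ~ is_abelian S ->
  exists S1, [/\ is_subgroup S1, S1 `<=` S, ~ is_abelian S1 & is_abelian (derived
    S1)].
Proof.
move=> hS [n]; elim: n S hS => [|n IHn] S hS /=.
  by move=> -> []; move=> x y -> ->.
rewrite -iterS iterSr => solS nabS.
have [ab|nab] := pselect (is_abelian (derived S)); first by exists S; split.
have [S1 [hS1 sub nab1 ab1]] := IHn _ (generated_subgroup _) solS nab.
by exists S1; split => // x /sub; exact: derived_sub.
Qed.

(* Either the derived subgroup of a non-abelian metabelian group is not
   centralized, or the group is nilpotent of class two. *)
Lemma nonabelian_solvable_pair S : is_subgroup S -> is_solvable S ->
  ~ is_abelian S ->
  exists a s A, [/\ S a, A a, ~ commute s a, forall b c, A b -> A c -> commute b c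
    & forall b, A b -> A (b ^ s) /\ A (b ^ s^-1)].
Proof.
move=> hS solS nabS.
have [S1 [hS1 sub nab ab]] := solvable_metabelian hS solS nabS.
have [S11 S1M S1V] := (subgroupP S1).1 hS1.
have [D1 DM DV] := (subgroupP _).1 (generated_subgroup _ : is_subgroup (derived
  S1)).
have dsub := derived_sub hS1.
have [[s [a [S1s Da sa]]]|cen] :=
  pselect (exists s a, [/\ S1 s, derived S1 a & ~ commute s a]).
  exists a, s, (derived S1); split => // [|b Db]; first exact/sub/dsub.
  have S1b := dsub _ Db; rewrite !conjg_commg.
  by split; apply: (DM) => //; apply: derived_commg => //; exact: S1V.
have cenP s a : S1 s -> derived S1 a -> commute s a.
  by move=> S1s Da; apply: contrapT => nc; apply: cen; exists s, a.
have [x [y [S1x S1y xy]]] : exists x y, [/\ S1 x, S1 y & ~ commute y x].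
  apply: contrapT => no; apply: nab => x y S1x S1y; apply: contrapT => nc.
  by apply: no; exists y, x.
(* When [derived S1] is central in [S1], its coset through [x] is commutative, and conjugation by
   [y] multiplies an element of it by a commutator, staying in the coset. *)
exists x, y, [set b | exists2 z, derived S1 z & b = x * z]; split => //.
- exact: sub.
- by exists 1; rewrite ?mulg1.
- move=> _ _ [z Dz ->] [z' Dz' ->].
  have S1z := dsub _ Dz; have S1z' := dsub _ Dz'.
  apply: commuteM; apply: commute_sym; apply: commuteM.
  + by [].
  + exact: cenP.
  + by apply: commute_sym; apply: cenP.
  + exact: cenP.
move=> _ [z Dz ->]; have S1xz : S1 (x * z) by apply: (S1M) => //; exact: dsub.
rewrite !conjg_commg -!mulgA.
by split; (eexists; last by []); apply: (DM) => //; apply: derived_commg => //;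
  exact: S1V.
Qed.

Lemma subnormal_subgroup H : is_subnormal H -> is_subgroup H.
Proof.
move=> [[|n] [N_ [N0 <- nN]]]; last by have [] := nN n (ltnSn n).
by rewrite N0; apply/subgroupP.
Qed.

(** The two-letter words [g i * (g j)^-1] show that [g] is injective, so reduced words over the
    image lift to reduced words over the indices. *)
Lemma free_basis_family (I : eqType) (g : I -> G) :
    (forall w : seq (I * bool),
      sorted (fun u v => ~~ ((u.1 == v.1) && (u.2 != v.2))) w -> w <> [::] ->
      \prod_(u <- w) (if u.2 then g u.1 else (g u.1)^-1) <> 1) ->
  free_basis [set x | exists i, x = g i] (generated [set x | exists i, x = g i]).
Proof.
move=> gP; split => // w wX red w0 w1.
have ginj : injective g.
  move=> i j gij; apply: contrapT => /eqP ij.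
  apply: (gP [:: (i, true); (j, false)]) => //=; first by rewrite (negPf ij).
  by rewrite !big_cons big_nil /= gij mulg1 mulgV.
have [w' wE] : exists w' : seq (I * bool), w = [seq (g u.1, u.2) | u <- w'].
  elim: w wX {red w0 w1} => [|x w IHw] wX; first by exists [::].
  have [|w' ->] := IHw; first by move=> y yw; apply: wX; rewrite inE yw orbT.
  have [i xi] := wX x (mem_head _ _).
  by exists ((i, x.2) :: w'); rewrite /= -xi -surjective_pairing.
apply: (gP w').
- move: red; rewrite wE /reduced sorted_map; congr (is_true _).
  by apply: eq_sorted => u v; rewrite /= /cancelling /= (inj_eq ginj).
- by move=> w'0; apply: w0; rewrite wE w'0.
- by rewrite -[RHS]w1 /word_val wE big_map.
Qed.

End Subgroups.

(** * Words in the multiplicative group *)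

Section GroupWords.
Local Open Scope group_scope.
Variable G : groupType.
Variables (a : G) (v : bool -> G).
Implicit Types (w : seq gen).

Definition gen_el (x : gen) : G :=
  match x with
  | (None, b) => if b then a else a^-1
  | (Some c, b) => if b then v c else (v c)^-1
  end.

Definition word_el w : G := \prod_(x <- w) gen_el x.

Lemma word_el_cat w w' : word_el (w ++ w') = word_el w * word_el w'.
Proof. exact: big_cat. Qed.

Lemma word_el_inv w : word_el (winv w) = (word_el w)^-1.
Proof.
elim: w => [|x w IHw]; first by rewrite /word_el !big_nil invg1.
rewrite -cat1s winv_cat !word_el_cat IHw invgM; congr (_ * _).
by rewrite /word_el !big_seq1; case: x => [[c|] []] /=; rewrite ?invgK.
Qed.

(** The element [a] lies in every term of the descending series. If [w] lies in [N_ i], then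
    [a * (w a^-1 w^-1)] lies in the normal subgroup [N_ i.+1], so each commutation goes one term
    deeper. *)
Lemma comm_word_mem (N_ : nat -> set G) n c : N_ 0%N = setT ->
    (forall i, (i < n)%N -> is_normal (N_ i.+1) (N_ i)) -> N_ n a ->
  forall i, (i <= n)%N -> N_ i (word_el (comm_word c i)).
Proof.
move=> N0 nN Na; have Nai i : (i <= n)%N -> N_ i a.
  move=> le_in; have : N_ (i + (n - i))%N a by rewrite subnKC.
  have : (i + (n - i) <= n)%N by rewrite subnKC.
  elim: (n - i)%N => [|k IHk]; first by rewrite addn0.
  rewrite addnS => lt_in Nk; apply: IHk (ltnW lt_in) _.
  by have [_ _ sub _] := nN _ lt_in; exact: sub.
elim=> [|i IHi] lt_in; first by rewrite N0.
have [hNS hNi _ nS] := nN i lt_in.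
have [_ _ NiV] := (subgroupP _).1 hNi.
have [_ NM NV] := (subgroupP _).1 hNS.
have -> : word_el (comm_word c i.+1) = a * a^-1 ^ (word_el (comm_word c i))^-1.
  rewrite [comm_word _ _]/= -cat1s -(cat1s (None, false)) !word_el_cat word_el_inv.
  by rewrite /word_el !big_seq1 /= conjgE invgK.
apply: NM; first exact: Nai.
by apply: nS; [exact/NV/Nai | exact/NiV/IHi/ltnW].
Qed.

Lemma expand_word_el n (w : seq (bool * bool)) :
  word_el (expand_word n w) =
  \prod_(x <- w) (if x.2 then word_el (basis_word n x.1)
                  else (word_el (basis_word n x.1))^-1).
Proof.
elim: w => [|x w IHw]; first by rewrite /word_el !big_nil.
rewrite big_cons -IHw /expand_word /= word_el_cat; congr (_ * _).
by rewrite /signed_word; case: x.2 => //; rewrite word_el_inv.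
Qed.

Lemma basis_word_mem (N_ : nat -> set G) n e : N_ 0%N = setT ->
    (forall i, (i < n)%N -> is_normal (N_ i.+1) (N_ i)) -> is_subgroup (N_ n) ->
      N_ n a ->
  N_ n (word_el (basis_word n e)).
Proof.
move=> N0 nN hN Na; have [_ NM NV] := (subgroupP _).1 hN.
have Nc c : N_ n (word_el (comm_word c n)) by exact: comm_word_mem nN Na _ _.
have Np := NM _ _ (Nc false) (Nc true).
case: e; rewrite /basis_word !word_el_cat //.
rewrite {1 4}/word_el !big_seq1 /=.
by apply: (NM) => //; apply: (NM) => //; exact: NV.
Qed.

End GroupWords.

(** * The free subgroup of a subnormal subgroup *)

Lemma val_word_el (D : divRingType) (a s : nonzero D) (v : bool ->
  nonzero D) (t u : D) :
    (forall c, val (v c) = 1 + u * pole (val a) (val s) c t)%R ->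
  forall w, val (word_el a v w) = word_eval (val a) (val s) t u w.
Proof.
move=> vE; elim=> [|x w IHw]; first by rewrite /word_el /word_eval !big_nil.
rewrite /word_el /word_eval !big_cons -/(word_el a v w) -/(word_eval _ _ _ _ w)
  -IHw.
by case: x => [[c|] []] /=; rewrite -?vE.
Qed.

Theorem corollary4p2 (D : divRingType)
    (hZ : ~ countable (ring_center D))
    (N : set (nonzero D)) (hN : is_subnormal N)
    (hS : exists S : set (nonzero D),
        [/\ is_subgroup S, S `<=` N, is_solvable S & ~ is_abelian S]) :
  exists F : set (nonzero D),
    [/\ is_subgroup F, F `<=` N, is_free F & ~ is_abelian F].
Proof.
have hN' := subnormal_subgroup hN.
have [S [hS1 SN solS nabS]] := hS.
have [a [s [A [Sa Aa nsa A_comm A_conj]]]] := nonabelian_solvable_pair hS1 solS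
  nabS.
have [n [N_ [N0 Nn nN]]] := hN.
have Na : N_ n a by rewrite Nn; exact: SN.
have AD_comm (b c : D) : (val @` A) b -> (val @` A) c -> (b * c = c * b)%R.
  move=> [b' Ab <-] [c' Ac <-].
  by have /(congr1 val) := A_comm _ _ Ab Ac.
have AD_conj (b : D) : (val @` A) b -> (val @` A) ((val s)^-1 * b * val s)%R.
  move=> [b' Ab <-]; exists (b' ^ s)%g; first by have [] := A_conj _ Ab.
  by rewrite conjgE /= mulrA.
have AD_conjV (b : D) : (val @` A) b -> (val @` A) (val s * b * (val s)^-1)%R.
  move=> [b' Ab <-]; exists (b' ^ s^-1)%g; first by have [] := A_conj _ Ab.
  by rewrite conjgE invgK /= mulrA.
have sa_neq : (val s * val a <> val a * val s)%R by move=> sa; apply: nsa;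
  exact: val_inj.
(* The length [n] of the subnormal series serves as the number of commutations with [a], which
   brings the basis elements into [N]. *)
have [t [u [Zt Zu adm free]]] :=
  generic_parameters (valP a) (valP s) (imageP _ Aa) AD_comm AD_conj AD_conjV
    sa_neq hZ n.
pose v c : nonzero D := exist (fun x : D => (x != 0)%R) _ (adm c).
pose g e := word_el a v (basis_word n e).
have gP (w : seq (bool * bool)) : reduced2 w -> w <> [::] ->
    (\prod_(x <- w) (if x.2 then g x.1 else (g x.1)^-1) <> 1)%g.
  move=> red w0; rewrite -expand_word_el => /(congr1 val).
  by rewrite (@val_word_el _ _ s _ t u) //; exact: free.
have basis := free_basis_family gP.
exists (generated [set x | exists e, x = g e]); split.
- exact: generated_subgroup.
- apply: generated_min => // _ [e ->]; rewrite -Nn.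
  by apply: basis_word_mem; rewrite // Nn.
- by exists [set x | exists e, x = g e].
move=> /(_ (g false) (g true)) ab.
(* The commutator of the two basis elements is a nonempty reduced word, so they cannot commute. *)
apply: (gP [:: (false, true); (true, true); (false, false); (true, false)]) => //.
rewrite !big_cons big_nil /= mulg1 -invgM mulgA ab.
- by rewrite mulgV.
- by apply: generated_sub; exists false.
- by apply: generated_sub; exists true.
Qed.
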